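(* Let $\underline{Q}$ be a lower transition rate operator on $\mathcal{L}(\mathcal{X})$, and let $f\in\mathcal{L}(\mathcal{X})$, $t\in\mathbb{R}_{\geq 0}$ and $\epsilon\in\mathbb{R}_{>0}$. Define $n$, $\delta$ and $g_0,\dots,g_n$ as follows: $g_0:=f$; if $\|f\|_c=0$ or $\|\underline{Q}\|=0$ or $t=0$, then $n:=0$ and $\delta:=0$; otherwise $$n:=\left\lceil \max\left\{\frac{t\|\underline{Q}\|}{2},\ \frac{t^2\|\underline{Q}\|^2\|f\|_c}{\epsilon}\right\}\right\rceil,\qquad \delta:=\frac{t}{n},\qquad g_{i+1}:=g_i+\delta\,\underline{Q}g_i\ \text{ for } i=0,\dots,n-1.$$ Then $$\|\underline{T}_t f-\Psi_t(n)f\|=\|\underline{T}_t f-g_n\|\leq \epsilon':=\delta^2\|\underline{Q}\|^2\sum_{i=0}^{n-1}\|g_i\|_c\leq\epsilon.$$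
   Context: $\mathcal{X}$ is a non-empty finite set and $\mathcal{L}(\mathcal{X})$ is the vector space of real-valued functions on $\mathcal{X}$; real numbers are identified with constant functions and inequalities between functions are pointwise. $\|f\|:=\max_{x}|f(x)|$, $\|f\|_v:=\max f-\min f$, $\|f\|_c:=\|f\|_v/2$. $\mathbb{I}_x$ is the indicator function of $\{x\}$, and $I$ is the identity operator. An operator $A:\mathcal{L}(\mathcal{X})\to\mathcal{L}(\mathcal{X})$ is non-negatively homogeneous if $A(\mu f)=\mu Af$ for all $\mu\ge 0$ and all $f$; its norm is $\|A\|:=\sup\{\|Af\|: \|f\|=1\}$. A lower transition rate operator is a map $\underline{Q}:\mathcal{L}(\mathcal{X})\to\mathcal{L}(\mathcal{X})$ such that for all $f,g\in\mathcal{L}(\mathcal{X})$, $\mu\geq 0$, $\gamma\in\mathbb{R}$ and $x\neq y$ in $\mathcal{X}$: $\underline{Q}\gamma=0$; $\underline{Q}(f+g)\geq\underline{Q}f+\underline{Q}g$; $\underline{Q}(\mu f)=\mu\underline{Q}f$; $[\underline{Q}\mathbb{I}_x](y)\geq 0$. For such $\underline{Q}$ and $f\in\mathcal{L}(\mathcal{X})$, $t\mapsto\underline{T}_tf$ denotes the unique solution on $\mathbb{R}_{\ge0}$ of $\frac{\mathrm d}{\mathrm dt}\underline{T}_tf=\underline{Q}\,\underline{T}_tf$ with $\underline{T}_0f=f$ (existence and uniqueness are known). For $n\geq1$ with $t\|\underline{Q}\|\leq 2n$, $\Psi_t(n):=(I+\frac tn\underline{Q})^n$, and $\Psi_t(0):=I$.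 An empty sum equals $0$. *)

(* Defs.v *)
From mathcomp Require Import all_boot all_order all_algebra.
From mathcomp Require Import all_classical all_reals all_analysis.
Set Implicit Arguments.
Unset Strict Implicit.
Unset Printing Implicit Defensive.
Import Order.TTheory GRing.Theory Num.Theory.
Import numFieldNormedType.Exports.
Local Open Scope classical_set_scope.
Local Open Scope ring_scope.

Definition max_norm (R : realType) (X : finType) (f : X -> R) : R :=
  \big[Num.max/0]_(x : X) `|f x|.

(* For a non-empty finite X, [range f] is finite and non-empty, so that its
   supremum and infimum are max f and min f. *)
Definition variation_norm (R : realType) (X : finType) (f : X -> R) : R :=
  sup (range f) - inf (range f).

Definition centred_norm (R : realType) (X : finType) (f : X -> R) : R :=
  variation_norm f / 2.

(* [sup] is real-valued and is 0 on unbounded sets; the set below is bounded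
   whenever A is a lower transition rate operator. *)
Definition op_norm (R : realType) (X : finType)
    (A : (X -> R) -> (X -> R)) : R :=
  sup [set max_norm (A f) | f in [set f | max_norm f = 1]].

Record lower_transition_rate_operator (R : realType) (X : finType)
    (Q : (X -> R) -> (X -> R)) : Prop := LowerTransitionRateOperator {
  ltro_cst : forall c : R, Q (cst c) = cst 0;
  ltro_superadditive :
    forall (f g : X -> R) (x : X), (Q f + Q g) x <= Q (f + g) x;
  ltro_homogeneous :
    forall (mu : R) (f : X -> R), 0 <= mu -> Q (mu *: f) = mu *: Q f;
  ltro_offdiag_ge0 :
    forall x y : X, x != y -> 0 <= Q \1_[set x] y }.

(* u solves u' = Q u on the half-line [0, +oo[ with u 0 = f. The derivative is
   taken relative to this half-line (hence one-sided at 0), in max_norm. *)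
Definition solves_rate_equation (R : realType) (X : finType)
    (Q : (X -> R) -> (X -> R)) (f : X -> R) (u : R -> X -> R) : Prop :=
  u 0 = f /\
  forall t : R, 0 <= t ->
    max_norm ((s - t)^-1 *: (u s - u t) - Q (u t))
      @[s --> within [set s : R | 0 <= s] t^'] --> (0 : R).

(* (I + (t / n) Q) ^ n, powers being iterated composition; at n = 0 this is the
   identity. *)
Definition Psi (R : realType) (X : finType) (Q : (X -> R) -> (X -> R))
    (t : R) (n : nat) : (X -> R) -> (X -> R) :=
  iter n (fun h : X -> R => h + (t / n%:R) *: Q h).

Definition degenerate (R : realType) (X : finType)
    (Q : (X -> R) -> (X -> R)) (f : X -> R) (t : R) : bool :=
  [|| centred_norm f == 0, op_norm Q == 0 | t == 0].

(* [absz] only converts to nat: the ceiling is taken of a nonnegative real. *)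
Definition num_steps (R : realType) (X : finType)
    (Q : (X -> R) -> (X -> R)) (f : X -> R) (t eps : R) : nat :=
  if degenerate Q f t then 0%N
  else absz (Num.ceil (Num.max (t * op_norm Q / 2)
         (t ^+ 2 * op_norm Q ^+ 2 * centred_norm f / eps))).

Definition step_size (R : realType) (X : finType)
    (Q : (X -> R) -> (X -> R)) (f : X -> R) (t eps : R) : R :=
  if degenerate Q f t then 0 else t / (num_steps Q f t eps)%:R.

(* Main.v *)
Require Import Defs.
From mathcomp Require Import all_boot all_order all_algebra.
From mathcomp Require Import all_classical all_reals all_analysis.
From mathcomp Require Import ring lra.
Import Order.TTheory GRing.Theory Num.Theory.
Import numFieldNormedType.Exports.
Local Open Scope classical_set_scope.
Local Open Scope ring_scope.

(** For [h * op_norm Q <= 2] the operator [I + h Q] preserves lower bounds and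
    is nonexpansive for [max_norm]. Compare the solution [u] on one step
    [[a, b]] with the affine path [p s = g + (s - a) Q g]: since [p' = Q g]
    differs from [Q (p s)] by at most [K = (b - a) (op_norm Q)^2 ||g||_c],
    nonexpansiveness bounds the upper right Dini derivative of [||u s - p s||]
    by [K], so each Euler step adds at most [(b - a) K] to the error. The
    second inequality holds because an Euler step does not increase the
    centred norm. *)

(** * Maximum norm and centred norm *)

Lemma max_norm_ge0 {R : realType} {X : finType} (f : X -> R) : 0 <= max_norm f.
Proof. exact: bigmax_ge_id. Qed.

Lemma ler_max_norm {R : realType} {X : finType} (f : X -> R) (x : X) :
  `|f x| <= max_norm f.
Proof. exact: (le_bigmax _ (fun x => `|f x|)). Qed.

Lemma max_norm_le {R : realType} {X : finType} (f : X -> R) (c : R) :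
  0 <= c -> (forall x, `|f x| <= c) -> max_norm f <= c.
Proof. by move=> c0 fc; apply: bigmax_le. Qed.

Lemma max_normD {R : realType} {X : finType} (f g : X -> R) :
  max_norm (f + g) <= max_norm f + max_norm g.
Proof.
apply: max_norm_le => [|x]; first by rewrite addr_ge0 ?max_norm_ge0.
by rewrite (le_trans (ler_normD _ _))// lerD ?ler_max_norm.
Qed.

Lemma max_normN {R : realType} {X : finType} (f : X -> R) :
  max_norm (- f) = max_norm f.
Proof. by apply: eq_bigr => x _; rewrite opprfctE normrN. Qed.

Lemma max_normZ {R : realType} {X : finType} (c : R) (f : X -> R) :
  max_norm (c *: f) = `|c| * max_norm f.
Proof.
have le (d : R) (g : X -> R) : max_norm (d *: g) <= `|d| * max_norm g.
  apply: max_norm_le => [|x]; first by rewrite mulr_ge0 ?max_norm_ge0.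
  by rewrite scalrfctE normrM ler_wpM2l ?ler_max_norm.
apply/eqP; rewrite eq_le le /=.
have [->|c0] := eqVneq c 0; first by rewrite normr0 mul0r max_norm_ge0.
rewrite -ler_pdivlMl ?normr_gt0// -normfV.
by have := le c^-1 (c *: f); rewrite scalerA mulVf// scale1r.
Qed.

Lemma max_norm0 {R : realType} {X : finType} : max_norm (0 : X -> R) = 0.
Proof. by rewrite -(scale0r 0) max_normZ normr0 mul0r. Qed.

Lemma max_norm0_eq0 {R : realType} {X : finType} (f : X -> R) :
  max_norm f = 0 -> f = 0.
Proof.
move=> f0; apply/funext => x; apply/eqP; rewrite -normr_le0 -f0.
exact: ler_max_norm.
Qed.

Lemma centred_norm_bounds {R : realType} {X : finType} (f : X -> R) :
  exists m M, (forall x, m <= f x <= M) /\ centred_norm f = (M - m) / 2.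
Proof.
exists (inf (range f)), (sup (range f)); split => // x.
apply/andP; split.
  apply: ge_inf; last by exists x.
  exists (- max_norm f) => _ [y _ <-].
  by have := ler_max_norm f y; rewrite ler_norml => /andP[].
apply: ub_le_sup; last by exists x.
exists (max_norm f) => _ [y _ <-].
exact: le_trans (ler_norm _) (ler_max_norm f y).
Qed.

(** On an empty [X] the defaults of [sup] and [inf] make the left side 0 while [M - m] may be
    negative, hence the hypothesis on [X]. *)
Lemma centred_norm_le {R : realType} {X : finType} (f : X -> R) (m M : R) :
  (0 < #|X|)%N -> (forall x, m <= f x <= M) -> centred_norm f <= (M - m) / 2.
Proof.
move=> /card_gt0P[x0 _] fmM; rewrite ler_pM2r ?invr_gt0// lerB//.
  by apply: ge_sup => [|_ [x _ <-]]; [exists (f x0), x0|case/andP: (fmM x)].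
by apply: lb_le_inf => [|_ [x _ <-]]; [exists (f x0), x0|case/andP: (fmM x)].
Qed.

Lemma centred_norm_ge0 {R : realType} {X : finType} (f : X -> R) :
  (0 < #|X|)%N -> 0 <= centred_norm f.
Proof.
move=> /card_gt0P[x _]; have [m [M [/(_ x)/andP[mf fM] ->]]] :=
  centred_norm_bounds f.
by rewrite divr_ge0// subr_ge0 (le_trans mf).
Qed.

(** * Bounds on the rate operator *)

Lemma rate0 {R : realType} {X : finType} {Q : (X -> R) -> (X -> R)}
    (HQ : lower_transition_rate_operator Q) : Q 0 = 0.
Proof. exact: ltro_cst HQ 0. Qed.

(** Superadditivity gives one inequality, as [Q] kills constants; adding [- c] to [f + cst c] gives
    the reverse one. *)
Lemma rate_cstD {R : realType} {X : finType} {Q : (X -> R) -> (X -> R)}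
    (HQ : lower_transition_rate_operator Q) (c : R) (f : X -> R) :
  Q (f + cst c) = Q f.
Proof.
have le (d : R) (g : X -> R) x : Q g x <= Q (g + cst d) x.
  have := ltro_superadditive HQ g (cst d) x.
  by rewrite (ltro_cst HQ) addrfctE /= addr0.
apply/funext => x; apply/eqP; rewrite eq_le le andbT.
have := le (- c) (f + cst c) x; rewrite -addrA.
suff -> : cst c + cst (- c) = 0 :> (X -> R) by rewrite addr0.
by apply/funext => y; rewrite addrfctE /= subrr.
Qed.

(** Superadditivity at [g = f + (g - f)]; this replaces linearity in all later comparisons. *)
Lemma rateB_le {R : realType} {X : finType} {Q : (X -> R) -> (X -> R)}
    (HQ : lower_transition_rate_operator Q) (f g : X -> R) (x : X) :
  Q f x - Q g x <= - Q (g - f) x.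
Proof.
have := ltro_superadditive HQ f (g - f) x.
by rewrite addrCA subrr addr0 addrfctE; lra.
Qed.

Lemma rate_diag_le {R : realType} {X : finType} {Q : (X -> R) -> (X -> R)}
    (HQ : lower_transition_rate_operator Q) (k : X -> R) (x : X) :
  (forall y, 0 <= k y) -> k x * Q \1_[set x] x <= Q k x.
Proof.
move=> k0.
have -> : Q k x = Q (\sum_(y <- enum X) k y *: \1_[set y]) x.
  congr (Q _ x); apply/funext => z; rewrite fct_sumE big_enum /= (bigD1 z)//=.
  rewrite big1 ?addr0 => [|y yz]; rewrite scalrfctE indicE.
    by rewrite mem_set//= /GRing.scale /= mulr1.
  by rewrite memNset ?scaler0//= => zy; rewrite zy eqxx in yz.
apply: (@le_trans _ _ (\sum_(y <- enum X) k y * Q \1_[set y] x)).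
  rewrite big_enum /= (bigD1 x)//= lerDl sumr_ge0// => y yx.
  by rewrite mulr_ge0// (ltro_offdiag_ge0 HQ).
elim: (enum X) => [|y s IH]; first by rewrite !big_nil (rate0 HQ).
rewrite !big_cons.
apply: le_trans (ltro_superadditive HQ _ _ x).
by rewrite addrfctE lerD// (ltro_homogeneous HQ)// scalrfctE.
Qed.

(** A crude bound with constant [2 * C] comes first: it shows that the set defining [op_norm Q] is
    bounded, so its [sup] is a true supremum. Normalising [f] then gives the sharp constant. *)
Lemma max_norm_rate_le {R : realType} {X : finType} {Q : (X -> R) -> (X -> R)}
    (HQ : lower_transition_rate_operator Q) (f : X -> R) :
  max_norm (Q f) <= op_norm Q * max_norm f.
Proof.
pose C := max_norm (fun x => Q \1_[set x] x).
have C0 : 0 <= C := max_norm_ge0 _.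
(* Shifting [g] by its norm leaves [Q g] unchanged and puts the values in [[0, 2 * max_norm g]]. *)
have low g x : - (2 * C * max_norm g) <= Q g x.
  rewrite -(rate_cstD HQ (max_norm g)).
  have g0 y : 0 <= (g + cst (max_norm g)) y <= 2 * max_norm g.
    by have := ler_max_norm g y; rewrite addrfctE /= ler_norml; lra.
  have g0' y : 0 <= (g + cst (max_norm g)) y by case/andP: (g0 y).
  apply: le_trans (rate_diag_le HQ _ x g0').
  have := ler_max_norm (fun x => Q \1_[set x] x) x; rewrite -/C ler_norml.
  by have := g0 x; nra.
have bound g : max_norm (Q g) <= 2 * C * max_norm g.
  apply: max_norm_le => [|x]; first by rewrite !mulr_ge0 ?max_norm_ge0.
  rewrite ler_norml low /=; have := low (- g) x; have := rateB_le HQ g 0 x.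
  by rewrite max_normN sub0r (rate0 HQ) -[(0 : X -> R) x]/(0 : R); lra.
have [f0|f0] := eqVneq (max_norm f) 0.
  by rewrite (le_trans (bound f))// f0 !mulr0.
have fp : 0 < max_norm f by rewrite lt0r f0 max_norm_ge0.
rewrite -ler_pdivrMr// mulrC -[X in X * _]ger0_norm ?invr_ge0 ?max_norm_ge0//.
rewrite -max_normZ -(ltro_homogeneous HQ) ?invr_ge0 ?max_norm_ge0//.
apply: ub_le_sup.
  by exists (2 * C) => _ [g /= g1 <-]; rewrite (le_trans (bound g))// g1 mulr1.
exists ((max_norm f)^-1 *: f) => //=.
by rewrite max_normZ ger0_norm ?invr_ge0 ?max_norm_ge0// mulVf.
Qed.

Lemma op_norm_ge0 {R : realType} {X : finType} (Q : (X -> R) -> (X -> R)) :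
  0 <= op_norm Q.
Proof.
rewrite /op_norm; set E := [set _ | _ in _].
(* When the set is empty or unbounded, [sup] takes its default value 0. *)
have [[[e Ee] ubE]|supE] := pselect (has_sup E); last by rewrite sup_out.
apply: le_trans (ub_le_sup ubE Ee).
by case: Ee => f _ <-; exact: max_norm_ge0.
Qed.

Lemma max_norm_rateB_le {R : realType} {X : finType} {Q : (X -> R) -> (X -> R)}
    (HQ : lower_transition_rate_operator Q) (f g : X -> R) :
  max_norm (Q f - Q g) <= op_norm Q * max_norm (f - g).
Proof.
apply: max_norm_le => [|x].
  by rewrite mulr_ge0 ?op_norm_ge0 ?max_norm_ge0.
have le (u v : X -> R) : Q u x - Q v x <= op_norm Q * max_norm (u - v).
  apply: le_trans (rateB_le HQ u v x) _.
  rewrite -max_normN opprB; apply: le_trans (max_norm_rate_le HQ _).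
  by apply: le_trans (ler_max_norm _ x); rewrite -normrN ler_norm.
have := le g f; have := le f g; rewrite -(max_normN (g - f)) opprB.
by rewrite -[X in `|X|]/(Q f x - Q g x) ler_norml; lra.
Qed.

(** Subtract the midpoint [(m + M) / 2], which [Q] ignores: the max norm of what remains is at most
    the centred norm of [f]. *)
Lemma max_norm_rate_centred_le {R : realType} {X : finType}
    {Q : (X -> R) -> (X -> R)} (HQ : lower_transition_rate_operator Q)
    (f : X -> R) :
  (0 < #|X|)%N -> max_norm (Q f) <= op_norm Q * centred_norm f.
Proof.
move=> X0; have [m [M [fmM fE]]] := centred_norm_bounds f.
rewrite -(rate_cstD HQ (- ((m + M) / 2))).
apply: le_trans (max_norm_rate_le HQ _) _.
rewrite ler_wpM2l ?op_norm_ge0// max_norm_le ?centred_norm_ge0// => x.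
by have := fmM x; rewrite fE addrfctE /= ler_norml; lra.
Qed.

(** An indicator has centred norm at most 1/2. This half is why steps up to [h * op_norm Q <= 2] are
    admissible. *)
Lemma rate_diag_ge {R : realType} {X : finType} {Q : (X -> R) -> (X -> R)}
    (HQ : lower_transition_rate_operator Q) (x : X) :
  - (op_norm Q / 2) <= Q \1_[set x] x.
Proof.
have X0 : (0 < #|X|)%N by apply/card_gt0P; exists x.
have := ler_max_norm (Q \1_[set x]) x.
have := max_norm_rate_centred_le HQ \1_[set x] X0.
have : centred_norm \1_[set x] <= (1 - 0) / 2 :> R.
  apply: centred_norm_le => // y; rewrite indicE.
  by case: (_ \in _); rewrite /= ?lexx ?ler01.
by have := op_norm_ge0 Q; rewrite ler_norml; nra.
Qed.

(** * Monotonicity properties of one Euler step *)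

Lemma euler_ge {R : realType} {X : finType} {Q : (X -> R) -> (X -> R)}
    (HQ : lower_transition_rate_operator Q) (h m : R) (k : X -> R) :
  0 <= h -> h * op_norm Q <= 2 -> (forall x, m <= k x) ->
  forall x, m <= (k + h *: Q k) x.
Proof.
(* After the shift to [k' >= 0], [rate_diag_le] leaves the lower bound [k' x * (1 + h * q)] with [q]
   the diagonal entry of [Q] at [x], and [rate_diag_ge] makes this factor nonnegative. *)
move=> h0 hQ mk x; set k' : X -> R := k + cst (- m).
have k0 y : 0 <= k' y by rewrite /k' addrfctE /= subr_ge0.
rewrite -[(_ + _) x]/(k x + h * Q k x) -(rate_cstD HQ (- m)) -/k'.
have := rate_diag_le HQ k' x k0; have := rate_diag_ge HQ x; have := k0 x.
have -> : k x = k' x + m by rewrite /k' addrfctE /= subrK.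
move: (k' x) (Q k' x) (Q _ x) (op_norm Q) hQ => d p q N hN d0 qN dq.
have hq : 0 <= h * (q + N / 2) by apply: mulr_ge0 => //; lra.
have dhq : 0 <= d * (1 + h * q) by apply: mulr_ge0 => //; lra.
have : h * (d * q) <= h * p by rewrite ler_wpM2l.
by lra.
Qed.

Lemma euler_le {R : realType} {X : finType} {Q : (X -> R) -> (X -> R)}
    (HQ : lower_transition_rate_operator Q) (h : R) (f g : X -> R) (M : R) :
  0 <= h -> h * op_norm Q <= 2 -> (forall x, f x - g x <= M) ->
  forall x, (f + h *: Q f) x - (g + h *: Q g) x <= M.
Proof.
move=> h0 hQ fgM x.
have k0 y : - M <= (g - f) y.
  by have := fgM y; rewrite -[(g - f) y]/(g y - f y); lra.
have := euler_ge HQ h (- M) (g - f) h0 hQ k0 x.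
have := rateB_le HQ f g x.
rewrite -[(f + _) x]/(f x + h * Q f x) -[(g + _) x]/(g x + h * Q g x).
rewrite -[(g - f + _) x]/(g x - f x + h * Q (g - f) x).
by nra.
Qed.

Lemma max_norm_eulerB_le {R : realType} {X : finType}
    {Q : (X -> R) -> (X -> R)} (HQ : lower_transition_rate_operator Q)
    (h : R) (f g : X -> R) :
  0 <= h -> h * op_norm Q <= 2 ->
  max_norm ((f + h *: Q f) - (g + h *: Q g)) <= max_norm (f - g).
Proof.
move=> h0 hQ; apply: max_norm_le => [|x]; first exact: max_norm_ge0.
have fg y : f y - g y <= max_norm (f - g).
  by apply: le_trans (ler_max_norm _ y); rewrite ler_norm.
have gf y : g y - f y <= max_norm (f - g).
  rewrite -max_normN opprB.
  by apply: le_trans (ler_max_norm _ y); rewrite ler_norm.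
have := euler_le HQ h _ _ _ h0 hQ fg x; have := euler_le HQ h _ _ _ h0 hQ gf x.
rewrite -[X in `|X|]/((f + h *: Q f) x - (g + h *: Q g) x) ler_norml.
by lra.
Qed.

(** The lower bound survives by [euler_ge], the upper one by [euler_le] against 0, a fixed point of
    the Euler step. *)
Lemma centred_norm_euler_le {R : realType} {X : finType}
    {Q : (X -> R) -> (X -> R)} (HQ : lower_transition_rate_operator Q)
    (h : R) (f : X -> R) :
  (0 < #|X|)%N -> 0 <= h -> h * op_norm Q <= 2 ->
  centred_norm (f + h *: Q f) <= centred_norm f.
Proof.
move=> X0 h0 hQ; have [m [M [fmM ->]]] := centred_norm_bounds f.
apply: centred_norm_le => // x; apply/andP; split.
  by apply: euler_ge => // y; case/andP: (fmM y).
have fM y : f y - (0 : X -> R) y <= M by rewrite subr0; case/andP: (fmM y).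
have := euler_le HQ h _ _ _ h0 hQ fM x.
by rewrite (rate0 HQ) scaler0 addr0 subr0.
Qed.

(** * Dini comparison and the error of one step *)

(* The first hypothesis on [phi] is the half of left continuity that lets a
   bound on [[a, s)] pass to [s]; the second bounds the right Dini derivative. *)
Lemma dini_le {R : realType} (phi : R -> R) (K a b : R) :
  a <= b ->
  (forall s, a <= s <= b -> exists M d, 0 < d /\
     forall r, a <= r <= s -> s - d < r -> phi s <= phi r + M * (s - r)) ->
  (forall s e, a <= s < b -> 0 < e -> exists d, 0 < d /\
     forall r, s <= r <= b -> r < s + d ->
       phi r <= phi s + (K + e) * (r - s)) ->
  phi b <= phi a + K * (b - a).
Proof.
move=> ab left right; apply/ler_addgt0Pr => e0 e0_gt0.
(* The [+ 1] in the witness covers [a = b]. *)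
have [e e_gt0 eE] : exists2 e, 0 < e & e * (b - a) <= e0.
  exists (e0 / (b - a + 1)); first by rewrite divr_gt0//; lra.
  by rewrite mulrAC ler_pdivrMr; nra.
pose bound r := phi a + (K + e) * (r - a).
(* Continuous induction: the supremum [c] of [S] satisfies the bound by the left hypothesis, and the
   right one would push past [c] if [c < b]. *)
pose S := [set s | a <= s <= b /\ forall r, a <= r <= s -> phi r <= bound r].
have Sa : S a.
  split=> [|r ra]; first by rewrite lexx ab.
  have -> : r = a by apply/eqP; rewrite eq_le; lra.
  by rewrite /bound subrr mulr0 addr0.
have ubS : ubound S b by move=> s [/andP[]].
have supS : has_sup S by split; [exists a|exists b].
set c := sup S.
have ac : a <= c by apply: ub_le_sup => //; exists b.
have cb : c <= b by apply: ge_sup => //; exists a.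
have below r : a <= r -> r < c -> phi r <= bound r.
  move=> ar rc; have [s [_ Ss] rs] : exists2 s, S s & r < s.
    have cr : 0 < c - r by rewrite subr_gt0.
    by have [s Ss] := sup_adherent cr supS; rewrite subKr => rs; exists s.
  by apply: Ss; rewrite ar ltW.
have atc : phi c <= bound c.
  have [M [d [d0 phiM]]] := left c (introT andP (conj ac cb)).
  have [ac'|ac'] := ltP a c; last first.
    have -> : c = a by apply/eqP; rewrite eq_le ac' ac.
    by apply: Sa.2; rewrite lexx.
  apply/ler_addgt0Pr => e1 e1_gt0.
  pose C := `|M| + `|K + e| + 1.
  have C0 : 0 < C.
    by rewrite /C; have := normr_ge0 M; have := normr_ge0 (K + e); lra.
  (* Step back from [c] by [h]: the entries keep [c - h] in the window of width [d], keep it above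
     [a], and make the loss from [M] and the slope at most [e1]. *)
  pose h := Num.min (Num.min (d / 2) (c - a)) (e1 / C).
  have h0 : 0 < h by rewrite !lt_min !divr_gt0// subr_gt0 ac'.
  have hd : h <= d / 2 by rewrite /h !ge_min lexx.
  have hc : h <= c - a by rewrite /h !ge_min lexx orbT.
  have he : h * C <= e1 by rewrite -ler_pdivlMr// /h !ge_min lexx !orbT.
  have r1 : a <= c - h <= c by lra.
  have r2 : c - d < c - h by lra.
  have r3 : a <= c - h by lra.
  have r4 : c - h < c by lra.
  have := phiM _ r1 r2; have := below _ r3 r4; rewrite /bound.
  have Mh : M * h <= `|M| * h by rewrite ler_pM2r ?ler_norm.
  have Kh : - (K + e) * h <= `|K + e| * h.
    by rewrite ler_pM2r// -normrN ler_norm.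
  by move: he; rewrite /C; lra.
suff cE : c = b by move: atc; rewrite /bound cE => atb; lra.
apply/eqP; rewrite eq_le cb leNgt; apply/negP => cltb.
have [d [d0 phid]] := right c e (introT andP (conj ac cltb)) e_gt0.
pose h := Num.min (d / 2) (b - c).
have h0 : 0 < h by rewrite lt_min divr_gt0// subr_gt0 cltb.
have hd : h <= d / 2 by rewrite /h ge_min lexx.
have hb : h <= b - c by rewrite /h ge_min lexx orbT.
suff : S (c + h) by move/(ub_le_sup supS.2); rewrite -/c; lra.
split=> [|r /andP[ar rch]]; first by lra.
have [/(below _ ar)//|cr] := ltP r c.
have r1 : c <= r <= b by lra.
have r2 : r < c + d by lra.
by have := phid _ r1 r2; move: atc; rewrite /bound; lra.
Qed.

(** The derivative with its division cleared; [r = s], excluded from the punctured limit, is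
    trivial. *)
Lemma solves_rate_equation_expansion {R : realType} {X : finType}
    {Q : (X -> R) -> (X -> R)} {f : X -> R} {u : R -> X -> R} (s e : R) :
  solves_rate_equation Q f u -> 0 <= s -> 0 < e ->
  exists2 d, 0 < d & forall r, 0 <= r -> `|r - s| < d ->
    max_norm (u r - u s - (r - s) *: Q (u s)) <= e * `|r - s|.
Proof.
move=> [_ /(_ s) du] s0 e0.
have {du} /cvgr0Pnorm_lt/(_ e e0) := du s0.
rewrite near_withinE => /nbhs_ballP[d /= d0 dP].
exists d => // r r0 rsd.
have [->|rs] := eqVneq r s.
  by rewrite !subrr scale0r subrr normr0 mulr0 max_norm0.
have rs0 : r - s != 0 by rewrite subr_eq0.
have := dP r; rewrite /ball /= distrC => /(_ rsd rs r0).
rewrite ger0_norm ?max_norm_ge0// => /ltW lee.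
rewrite mulrC -(ler_pdivrMl _ _ (_ : 0 < `|r - s|)) ?normr_gt0//.
by rewrite -normfV -max_normZ scalerBr scalerA mulVf// scale1r.
Qed.

(** Nonexpansiveness is applied only to short increments [r - s], so [b - a] may have any length. *)
Lemma euler_step {R : realType} {X : finType} {Q : (X -> R) -> (X -> R)}
    {f : X -> R} {u : R -> X -> R} (a b : R) (g : X -> R) :
  (0 < #|X|)%N -> lower_transition_rate_operator Q ->
  solves_rate_equation Q f u -> 0 <= a -> a <= b ->
  max_norm (u b - (g + (b - a) *: Q g)) <=
    max_norm (u a - g) + (b - a) ^+ 2 * op_norm Q ^+ 2 * centred_norm g.
Proof.
move=> X0 HQ Hu a0 ab.
pose p s := g + (s - a) *: Q g.
pose K := (b - a) * op_norm Q ^+ 2 * centred_norm g.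
have N0 := op_norm_ge0 Q.
have -> : max_norm (u a - g) = max_norm (u a - p a).
  by rewrite /p subrr scale0r addr0.
have -> : (b - a) ^+ 2 * op_norm Q ^+ 2 * centred_norm g = K * (b - a).
  by rewrite /K; ring.
apply: (dini_le (fun s => max_norm (u s - p s))) => // [s|s e] /andP[a_s s_b].
  have s0 : 0 <= s := le_trans a0 a_s.
  have [d d0 ud] := solves_rate_equation_expansion s 1 Hu s0 ltr01.
  (* The 1 is the expansion error; the norm is that of the derivative of [u - p] at [s]. *)
  exists (1 + max_norm (Q (u s) - Q g)), d; split=> // r /andP[ar rs] dr.
  have -> : u s - p s = (u r - p r) + (- (u r - u s - (r - s) *: Q (u s)) +
      (s - r) *: (Q (u s) - Q g)).
    apply/funext => x.
    rewrite /p !(addrfctE, opprfctE, scalrfctE) /GRing.scale /=; ring.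
  apply: le_trans (max_normD _ _) _; rewrite lerD2l.
  apply: le_trans (max_normD _ _) _; rewrite max_normN mulrDl lerD//.
    have -> : s - r = `|r - s| by rewrite distrC ger0_norm ?subr_ge0.
    apply: ud; first exact: le_trans ar.
    by rewrite distrC ger0_norm ?subr_ge0//; lra.
  by rewrite max_normZ ger0_norm ?subr_ge0// mulrC.
move=> e0; have s0 : 0 <= s := le_trans a0 a_s.
have [d d0 ud] := solves_rate_equation_expansion s e Hu s0 e0.
(* The second entry ensures [(r - s) * op_norm Q <= 2], even if [op_norm Q] is 0. *)
exists (Num.min d (2 / (op_norm Q + 1))); split.
  by rewrite lt_min d0 divr_gt0//; lra.
move=> r /andP[sr rb]; rewrite -ltrBlDl lt_min => /andP[rd rN].
have h0 : 0 <= r - s by rewrite subr_ge0.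
have hN : (r - s) * op_norm Q <= 2.
  by move: rN; rewrite ltr_pdivlMr; lra.
(* Difference of two Euler steps of length [r - s], plus the defect of [p] (bounded by [K]) and the
   expansion error (bounded by [e]), both relative to [r - s]. *)
have -> : u r - p r = (u s + (r - s) *: Q (u s) - (p s + (r - s) *: Q (p s))) +
    ((r - s) *: (Q (p s) - Q g) + (u r - u s - (r - s) *: Q (u s))).
  apply/funext => x.
  rewrite /p !(addrfctE, opprfctE, scalrfctE) /GRing.scale /=; ring.
apply: le_trans (max_normD _ _) _; apply: lerD; first exact: max_norm_eulerB_le.
apply: le_trans (max_normD _ _) _; rewrite mulrDl; apply: lerD; last first.
  by rewrite -[in leRHS](ger0_norm h0) ud ?(le_trans s0)// ger0_norm.
rewrite max_normZ ger0_norm// mulrC ler_wpM2r//.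
apply: le_trans (max_norm_rateB_le HQ _ _) _.
have -> : p s - g = (s - a) *: Q g by rewrite /p addrC addKr.
have -> : K = op_norm Q * ((b - a) * (op_norm Q * centred_norm g)).
  by rewrite /K; ring.
rewrite ler_wpM2l// max_normZ ger0_norm ?subr_ge0//.
apply: ler_pM; rewrite ?subr_ge0 ?max_norm_ge0 ?lerD2r ?(ltW s_b)//.
exact: max_norm_rate_centred_le.
Qed.

(** * Accumulation of the errors over the grid *)

Theorem theorem5 (R : realType) (X : finType) (Xne : (0 < #|X|)%N)
    (Q : (X -> R) -> (X -> R)) (HQ : lower_transition_rate_operator Q)
    (f : X -> R) (t eps : R) (t_ge0 : 0 <= t) (eps_gt0 : 0 < eps)
    (Tf : R -> X -> R) (HTf : solves_rate_equation Q f Tf)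
    (n : nat) (Hn : n = num_steps Q f t eps)
    (delta : R) (Hdelta : delta = step_size Q f t eps)
    (g : nat -> X -> R) (Hg0 : g 0%N = f)
    (HgS : forall i : nat, (i < n)%N -> g i.+1 = g i + delta *: Q (g i))
    (eps' : R)
    (Heps' : eps' =
       delta ^+ 2 * op_norm Q ^+ 2 * \sum_(0 <= i < n) centred_norm (g i)) :
  [/\ max_norm (Tf t - Psi Q t n f) = max_norm (Tf t - g n),
      max_norm (Tf t - g n) <= eps'
    & eps' <= eps].
Proof.
have N0 := op_norm_ge0 Q; have fc0 := centred_norm_ge0 f Xne.
case: (boolP (degenerate Q f t)) => [deg|ndeg].
  have n0 : n = 0%N by rewrite Hn /num_steps deg.
  have -> : eps' = 0 by rewrite Heps' n0 big_geq// mulr0.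
  rewrite n0 Hg0 /Psi /=; split=> //; last exact: ltW.
  (* The solution has not moved from [f]: in a single [euler_step] of length [t] from [f], both the
     increment and the error term vanish with this product. *)
  have tNf : t * (op_norm Q * centred_norm f) = 0.
    by case/or3P: deg => /eqP->; rewrite ?mul0r ?mulr0.
  have tQf : t *: Q f = 0.
    apply/max_norm0_eq0/eqP; rewrite eq_le max_norm_ge0 andbT.
    by rewrite max_normZ ger0_norm// -tNf ler_wpM2l// max_norm_rate_centred_le.
  have := euler_step 0 t f Xne HQ HTf (lexx 0) t_ge0.
  rewrite subr0 tQf addr0 HTf.1 subrr.
  have -> : t ^+ 2 * op_norm Q ^+ 2 * centred_norm f =
    t * op_norm Q * (t * (op_norm Q * centred_norm f)) by ring.
  by rewrite tNf mulr0 addr0 max_norm0.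
move: (ndeg); rewrite !negb_or => /and3P[fc_neq0 Q_neq0 t_neq0].
have tp : 0 < t by rewrite lt0r t_neq0.
have Np : 0 < op_norm Q by rewrite lt0r Q_neq0.
have fcp : 0 < centred_norm f by rewrite lt0r fc_neq0.
have [n_ge1 n_ge2] : t * op_norm Q / 2 <= n%:R /\
    t ^+ 2 * op_norm Q ^+ 2 * centred_norm f / eps <= n%:R.
  apply/andP; rewrite -ge_max Hn /num_steps (negbTE ndeg).
  set m := Num.max _ _.
  (* Positivity ensures that [absz] leaves the ceiling unchanged. *)
  have m0 : 0 < m by rewrite lt_max divr_gt0// mulr_gt0.
  apply: le_trans (ceil_ge m) _.
  have c0 : 0 <= Num.ceil m by rewrite ltW// ceil_gt0.
  by rewrite -[X in X%:~R <= _](gez0_abs c0).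
have np : 0 < n%:R :> R.
  by apply: lt_le_trans n_ge1; rewrite divr_gt0// mulr_gt0.
have deltaE : delta = t / n%:R by rewrite Hdelta /step_size (negbTE ndeg) Hn.
have delta0 : 0 <= delta by rewrite deltaE divr_ge0.
have deltaN : delta * op_norm Q <= 2.
  by rewrite deltaE mulrAC ler_pdivrMr//; lra.
have deltan : delta * n%:R = t by rewrite deltaE divfK ?gt_eqF.
have gPsi i : (i <= n)%N -> iter i (fun h => h + (t / n%:R) *: Q h) f = g i.
  by elim: i => [//|i IH] lin; rewrite iterS IH ?HgS -?deltaE// ltnW.
have gc i : (i <= n)%N -> centred_norm (g i) <= centred_norm f.
  elim: i => [|i IH] lin; first by rewrite Hg0.
  by rewrite HgS// (le_trans _ (IH (ltnW lin)))// centred_norm_euler_le.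
(* Induction along the grid points [delta * i], with one [euler_step] started at [g i] each time. *)
have err i : (i <= n)%N -> max_norm (Tf (delta * i%:R) - g i) <=
    delta ^+ 2 * op_norm Q ^+ 2 * \sum_(0 <= j < i) centred_norm (g j).
  elim: i => [|i IH] lin.
    by rewrite mulr0 HTf.1 Hg0 subrr big_geq// mulr0 max_norm0.
  rewrite big_nat_recr//= mulrDr HgS//.
  have := euler_step (delta * i%:R) (delta * i.+1%:R) (g i) Xne HQ HTf.
  rewrite -mulrBr -natrB// subSnn mulr1.
  move=> /(_ (mulr_ge0 delta0 (ler0n _ _))).
  rewrite ler_wpM2l ?ler_nat// => /(_ isT) step.
  by apply: le_trans step _; rewrite lerD2r IH// ltnW.
split; first by rewrite /Psi gPsi.
  by rewrite Heps' -{1}deltan err.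
have sum_le : \sum_(0 <= i < n) centred_norm (g i) <= n%:R * centred_norm f.
  rewrite mulr_natl -[n in leRHS]subn0 -sumr_const_nat.
  by apply: ler_sum_nat => i /andP[_ lin]; rewrite gc// ltnW.
rewrite Heps'; apply: le_trans (ler_wpM2l _ sum_le) _.
  by rewrite mulr_ge0 ?sqr_ge0.
(* After multiplication by [n], [delta * n = t] turns the claim into the second bound on [n]. *)
move: n_ge2; rewrite ler_pdivrMr// => n_ge2.
rewrite -(ler_pM2l np); apply: le_trans n_ge2.
by rewrite le_eqVlt -deltan; apply/orP; left; apply/eqP; ring.
Qed.
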